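(* Let $X$ be a chainable continuum, let $\mathcal{U}$ be a non-principal ultrafilter on $\mathbb{N}$, and let $\mathcal{D}=\{D_n\}_{n\in\mathbb{N}}$ be any sequence of chains covering $X$ such that $\mathrm{mesh}(D_n)\to0$ as $n\to\infty$. Let $P$ be one of the intervals $(0,1)$, $(0,1]$, $[0,1]$. Assume that $L\subseteq X$ and $L=h(P)$, where $h\colon P\to L$ is a homeomorphism. Let $\leq_{L}$ be the order on $L$ such that for all $x,y\in P$, $x\le y\iff h(x)\leq_L h(y)$. Then the order $\leq_L$ and the restriction of $\leq_{\mathcal{U}}^{\mathcal{D}}$ to $L$ either coincide or are opposite to each other, i.e. $$\big(\forall_{x,y\in P}\ h(x)\leq_L h(y)\iff h(x)\leq_{\mathcal{U}}^{\mathcal{D}}h(y)\big)\ \vee\ \big(\forall_{x,y\in P}\ h(x)\leq_L h(y)\iff h(x)\geq_{\mathcal{U}}^{\mathcal{D}}h(y)\big).$$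
   Context: A continuum is a compact connected metrizable space; fix a metric generating its topology. A chain in $X$ is a finite sequence of open sets $d_1,\dots,d_k$ (its links) with $d_i\cap d_j\neq\varnothing\iff|i-j|\le 1$; its mesh is the maximum of the diameters of its links. $X$ is chainable if for every $\varepsilon>0$ it is covered by a chain of mesh less than $\varepsilon$. $\mathbb{N}=\{1,2,3,\dots\}$. Let $\mathcal{D}=\{D_n\}_{n\in\mathbb{N}}$ be a sequence of chains $D_n=\{d_{1,n},\dots,d_{k_n,n}\}$, each covering $X$, with $\mathrm{mesh}(D_n)\to 0$, and let $\mathcal{U}$ be a non-principal ultrafilter on $\mathbb{N}$. Write $x\leq_{D_n}y$ iff there exist $i\le j\le k_n$ with $x\in d_{i,n}$ and $y\in d_{j,n}$, and $x\leq_{\mathcal{U}}^{\mathcal{D}}y$ iff $\{n\in\mathbb{N}: x\leq_{D_n}y\}\in\mathcal{U}$. This is a linear order on $X$. *)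

(* Defs.v *)
From HB Require Import structures.
From mathcomp Require Import all_boot all_order all_algebra.
From mathcomp Require Import all_classical all_reals all_analysis.

Set Implicit Arguments.
Unset Strict Implicit.
Unset Printing Implicit Defensive.

Import Order.TTheory GRing.Theory Num.Theory.
Import numFieldNormedType.Exports.

Local Open Scope classical_set_scope.
Local Open Scope ring_scope.

(* The metrizable spaces are the spaces [X : metricType R]: the metric is part
   of the structure and generates the topology. *)
Definition continuum {R : realType} (X : metricType R) : Prop :=
  compact [set: X] /\ connected [set: X].

(* Extended-real valued, so that no boundedness is presupposed; the diameter
   of the empty set is -oo, but the links of a chain are nonempty. *)
Definition diam {R : realType} {X : metricType R} (A : set X) : \bar R :=
  ereal_sup [set e | exists x y, [/\ A x, A y & e = (mdist x y)%:E]].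

(* A finite sequence of sets d_1, ..., d_k is a [D : seq (set X)]; positions
   are numbered from 0, so d_i is [nth set0 D i.-1]. *)
Definition chain {X : topologicalType} (D : seq (set X)) : Prop :=
  (forall i, (i < size D)%N -> open (nth set0 D i)) /\
  (forall i j, (i < size D)%N -> (j < size D)%N ->
     (nth set0 D i `&` nth set0 D j !=set0 <-> (`|i - j| <= 1)%N)).

Definition covers {X : Type} (D : seq (set X)) : Prop :=
  forall x, exists2 i, (i < size D)%N & nth set0 D i x.

Definition mesh {R : realType} {X : metricType R} (D : seq (set X)) : \bar R :=
  \big[maxe/0%E]_(A <- D) diam A.

Definition chainable {R : realType} (X : metricType R) : Prop :=
  forall e : R, 0 < e ->
    exists D : seq (set X), [/\ chain D, covers D & (mesh D < e%:E)%E].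

Definition le_chain {X : Type} (D : seq (set X)) (x y : X) : Prop :=
  exists i j : nat,
    [/\ (i <= j < size D)%N, nth set0 D i x & nth set0 D j y].

(* Sequences indexed by 1, 2, 3, ... are reindexed by [nat]. *)
Definition le_ultra {X : Type} (D : nat -> seq (set X)) (U : set_system nat)
    (x y : X) : Prop :=
  U [set n | le_chain (D n) x y].

Definition nonprincipal {T : Type} (U : set_system T) : Prop :=
  forall t : T, U <> principal_filter t.

(* [h] is a homeomorphism from the subspace [P] onto the subspace [L]; the
   values of [h] outside [P] and of its inverse outside [L] are irrelevant. *)
Definition homeomorphism_on {S T : topologicalType} (P : set S) (L : set T)
    (h : S -> T) : Prop :=
  [/\ set_bij P L h,
      {within P, continuous h} &
      exists2 g : T -> S,
        forall s, P s -> g (h s) = s & {within L, continuous g}].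

(* Main.v *)
Require Import Defs.
From mathcomp Require Import all_boot all_order all_algebra.
From mathcomp Require Import all_classical all_reals all_analysis.
From mathcomp Require Import zify.
Import Order.TTheory GRing.Theory Num.Theory.
Import numFieldNormedType.Exports.
Local Open Scope classical_set_scope.
Local Open Scope ring_scope.

(** Why the theorem holds: a connected set that meets two links of a chain
    meets every link between them ([connected_meets_link]).  So if [K] is
    connected, contains [x] and [y], and [z] lies between [x] and [y] for the
    order of [D n], then some link containing [z] meets [K], and [z] is within
    [mesh (D n)] of [K] ([le_chain_between_close]).  The meshes tend to 0 and a
    non-principal ultrafilter contains every cofinite set; hence, for the limit
    order, a point between two points of a closed connected set [K] belongs to
    [K] ([le_ultra_between]): closed connected sets are order convex.

    Apply this to the arcs [h @` [a, b]], which are compact and connected.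
    Pulled back to [P] along the injective map [h], the limit order becomes a
    total relation for which every point between [a] and [b] lies in the
    segment with ends [a] and [b].  Such a relation is the usual order or its
    reverse ([total_between_monotone]). *)

(** * Relations whose intervals are contained in segments *)

(** Among three points [a < b < c] only [b] can be between the two others, so
    the three pairs are oriented alike; any two pairs are compared through the
    pair formed by their least and greatest points.  The case [a = b] of
    [Fbetween] is the antisymmetry of [F]. *)
Lemma total_between_monotone {d : Order.disp_t} {T : orderType d} (A : set T)
    (F : T -> T -> Prop)
    (Ftotal : forall a b, A a -> A b -> F a b \/ F b a)
    (Fbetween : forall a b c, A a -> A b -> A c -> F a c -> F c b ->
       (a <= c <= b)%O \/ (b <= c <= a)%O) :
  (forall x y, A x -> A y -> ((x <= y)%O <-> F x y)) \/
  (forall x y, A x -> A y -> ((x <= y)%O <-> F y x)).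
Proof.
have orient a b c : A a -> A b -> A c -> (a < b)%O -> (b < c)%O ->
    [/\ F a b -> F a c, F a c -> F a b, F a c -> F b c & F b c -> F a c].
  move=> Aa Ab Ac ab bc; have ac := lt_trans ab bc.
  have nab : ~ (b <= a)%O by rewrite leNgt ab.
  have nbc : ~ (c <= b)%O by rewrite leNgt bc.
  have nac : ~ (c <= a)%O by rewrite leNgt ac.
  split=> H.
  - have [//|ca] := Ftotal a c Aa Ac.
    by have [/andP[]|/andP[]] := Fbetween _ _ _ Ac Ab Aa ca H.
  - have [//|ba] := Ftotal a b Aa Ab.
    by have [/andP[]|/andP[]] := Fbetween _ _ _ Ab Ac Aa ba H.
  - have [//|cb] := Ftotal b c Ab Ac.
    by have [/andP[]|/andP[]] := Fbetween _ _ _ Aa Ab Ac H cb.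
  - have [//|ca] := Ftotal a c Aa Ac.
    by have [/andP[]|/andP[]] := Fbetween _ _ _ Ab Aa Ac H ca.
have widenr a b c : A a -> A b -> A c -> (a < b)%O -> (b <= c)%O ->
    F a b <-> F a c.
  move=> Aa Ab Ac ab; rewrite le_eqVlt => /predU1P[-> //|bc].
  by have [] := orient a b c Aa Ab Ac ab bc.
have widenl a b c : A a -> A b -> A c -> (a <= b)%O -> (b < c)%O ->
    F b c <-> F a c.
  move=> Aa Ab Ac; rewrite le_eqVlt => /predU1P[-> //|ab bc].
  by have [] := orient a b c Aa Ab Ac ab bc.
have uniform a b x y : A a -> A b -> A x -> A y -> (a < b)%O -> (x < y)%O ->
    F a b -> F x y.
  move=> Aa Ab Ax Ay ab xy Fab.
  set m := Order.min a x; set M := Order.max b y.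
  have Am : A m by rewrite /m; case: ltP.
  have AM : A M by rewrite /M; case: ltP.
  have [ma mx] : (m <= a)%O /\ (m <= x)%O by rewrite !ge_min !lexx orbT.
  have [bM yM] : (b <= M)%O /\ (y <= M)%O by rewrite !le_max !lexx orbT.
  apply/(widenl m x y) => //; apply/(widenr m y M) => //.
    exact: le_lt_trans xy.
  apply/(widenr m b M) => //; first exact: le_lt_trans ab.
  exact/(widenl m a b).
have Frefl a : A a -> F a a by move=> Aa; have [] := Ftotal a a Aa Aa.
have Fanti a b : A a -> A b -> F a b -> F b a -> a = b.
  move=> Aa Ab Fab Fba.
  by have [/le_anti|/le_anti] := Fbetween _ _ _ Aa Aa Ab Fab Fba.
have [[a [b [Aa Ab ab Fab]]]|none] :=
  pselect (exists a b, [/\ A a, A b, (a < b)%O & F a b]); [left|right].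
- move=> x y Ax Ay; split=> [|Fxy].
    rewrite le_eqVlt => /predU1P[<-|xy]; first exact: Frefl.
    exact: (uniform a b).
  case: leP => // yx; have Fyx : F y x by exact: (uniform a b).
  by rewrite (Fanti x y) ?ltxx in yx.
- have Fgt x y : A x -> A y -> (x < y)%O -> ~ F x y.
    by move=> Ax Ay xy Fxy; apply: none; exists x, y.
  move=> x y Ax Ay; split=> [|Fyx].
    rewrite le_eqVlt => /predU1P[<-|xy]; first exact: Frefl.
    by have [/Fgt -/(_ Ax Ay xy)|] := Ftotal x y Ax Ay.
  by case: leP => // /Fgt -/(_ Ay Ax).
Qed.

(** * Connected sets and the order of one chain *)

(** Otherwise the links before the [j]-th and those after it would separate
    [K]: they are disjoint, because links at distance 2 or more are. *)
Lemma connected_meets_link {X : topologicalType} (D : seq (set X)) (K : set X)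
    (i j l : nat) (x y : X) :
  chain D -> covers D -> connected K -> K x -> K y ->
  (i < j < l)%N -> (l < size D)%N -> nth set0 D i x -> nth set0 D l y ->
  K `&` nth set0 D j !=set0.
Proof.
move=> [Dopen Dmeet] Dcov Kconn Kx Ky ijl lD xi yl.
apply: contrapT => Kj0.
pose before := \bigcup_(m in [set m | (m < j)%N]) nth set0 D m.
pose after :=
  \bigcup_(m in [set m | (j < m < size D)%N]) nth set0 D m.
have before_open : open before.
  by apply: bigcup_open => m /= mj; apply: Dopen; lia.
have after_open : open after.
  by apply: bigcup_open => m /= /andP[_ mD]; apply: Dopen.
have disj z : before z -> after z -> False.
  move=> [m /= mj zm] [p /= jp zp].
  have /(Dmeet m p) : nth set0 D m `&` nth set0 D p !=set0 by exists z.
  by move=> /(_ ltac:(lia) ltac:(lia)); lia.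
have KU z : K z -> before z \/ after z.
  move=> Kz; have [m mD zm] := Dcov z.
  have [mj|jm|mj] := ltngtP m j; first by left; exists m.
    by right; exists m => //=; rewrite jm.
  by case: Kj0; exists z; rewrite -mj.
have KB : K `&` before = K.
  apply: Kconn; first by exists x; split=> //; exists i => //=; lia.
    by exists before.
  exists (~` after); first exact: open_closedC.
  apply/seteqP; split=> z [Kz Hz]; split=> //; first by move=> /disj; apply.
  by case: (KU z Kz).
have [_ yb] : (K `&` before) y by rewrite KB.
by apply: (disj y) => //; exists l => //=; lia.
Qed.

Lemma mdist_lt_mesh {R : realType} {X : metricType R} (D : seq (set X)) (i : nat)
    (x y : X) (e : R) :
  (i < size D)%N -> nth set0 D i x -> nth set0 D i y -> (mesh D < e%:E)%E ->
  mdist x y < e.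
Proof.
move=> iD xi yi De; rewrite -lte_fin; apply: le_lt_trans De.
apply: (@le_trans _ _ (diam (nth set0 D i))).
  by apply: ereal_sup_ubound; exists x, y.
by rewrite /mesh; apply: le_bigmax_seq => //; apply: mem_nth.
Qed.

(** The two comparisons may place [z] in two different links, which are then
    equal or adjacent.  Let [j] be the link that compares [z] with [x].  If
    [j] is strictly between the links [i] of [x] and [l] of [y], then [K]
    meets the link [j]; otherwise adjacency forces [z] to share a link with [x] or with [y]. *)
Lemma le_chain_between_close {R : realType} {X : metricType R}
    (D : seq (set X)) (K : set X) (x y z : X) (e : R) :
  chain D -> covers D -> connected K -> K x -> K y ->
  le_chain D x z -> le_chain D z y -> (mesh D < e%:E)%E ->
  exists2 w, K w & mdist z w < e.
Proof.
move=> Dchain Dcov Kconn Kx Ky [i [j [/andP[ij jD] xi zj]]].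
move=> [k [l [/andP[kl lD] zk yl]]] De.
have [ji|{}ij] := leqP j i.
  have {}ij : i = j by lia.
  by exists x => //; apply: (mdist_lt_mesh D j) De => //; rewrite -ij.
have [jl|lj] := ltnP j l.
  have [w [Kw wj]] : K `&` nth set0 D j !=set0.
    by apply: (connected_meets_link D K i j l x y) => //; rewrite ij.
  by exists w => //; apply: (mdist_lt_mesh D j) De.
have jk : (`|j - k| <= 1)%N.
  by apply/(proj2 Dchain) => //; [exact: leq_ltn_trans lD|exists z].
have zl : nth set0 D l z.
  by have [<-|<-] // : k = l \/ j = l by lia.
by exists y => //; apply: (mdist_lt_mesh D l) De.
Qed.

Lemma le_chain_total {X : Type} (D : seq (set X)) (x y : X) :
  covers D -> le_chain D x y \/ le_chain D y x.
Proof.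
move=> Dcov; have [i iD xi] := Dcov x; have [j jD yj] := Dcov y.
have [ij|ji] := leqP i j; [left; exists i, j|right; exists j, i].
  by rewrite ij.
by rewrite (ltnW ji).
Qed.

(** * Passage to the ultralimit *)

(** If the tail from [N] is in [U] but the tail from [N + 1] is not, then
    [{N}] is in [U]. *)
Lemma nonprincipal_cofinite (U : set_system nat) :
  UltraFilter U -> nonprincipal U -> \oo `<=` U.
Proof.
move=> Uultra Unp A [N _ NA].
have UF : Filter U by exact: _.
apply: (filterS NA) => {NA}.
elim: N => [|N IHN]; first by apply: filterS filterT.
have [UN|UN] := in_ultra_setVsetC [set N] Uultra.
  case: (Unp N); apply: (@max_filter _ _ (principal_filter_ultra N)) => B /= NB.
  by apply: filterS UN => n ->; apply: NB.
apply: filterS (filterI IHN UN) => n [/= Nn nN].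
by rewrite ltn_neqAle Nn andbT; apply/eqP => /esym.
Qed.

Lemma le_ultra_total {X : Type} (D : nat -> seq (set X)) (U : set_system nat)
    (x y : X) :
  UltraFilter U -> (forall n, covers (D n)) ->
  le_ultra D U x y \/ le_ultra D U y x.
Proof.
move=> Uultra Dcov.
have [|Uxy] := in_ultra_setVsetC [set n | le_chain (D n) x y] Uultra.
  by left.
right; apply: filterS Uxy => n /= nxy.
by have [//|] := le_chain_total (D n) x y (Dcov n).
Qed.

(** A point outside the closed set [K] is at some distance [e > 0] from it,
    while it is within [mesh (D n) < e] of [K] for [U]-almost every [n]. *)
Lemma le_ultra_between {R : realType} {X : metricType R}
    (D : nat -> seq (set X)) (U : set_system nat) (K : set X) (x y z : X) :
  UltraFilter U -> nonprincipal U ->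
  (forall n, chain (D n)) -> (forall n, covers (D n)) ->
  mesh (D n) @[n --> \oo] --> 0%E ->
  connected K -> closed K -> K x -> K y ->
  le_ultra D U x z -> le_ultra D U z y -> K z.
Proof.
move=> Uultra Unp Dchain Dcov Dmesh Kconn Kclosed Kx Ky xz zy.
apply: Kclosed => B /nbhs_ballP[e /= e0 eB].
have Usmall : U [set n | (mesh (D n) < e%:E)%E].
  apply: nonprincipal_cofinite => //; apply: (Dmesh [set u | (u < e%:E)%E]).
  by apply: open_ereal_lt'; rewrite lte_fin.
have [n [/= De [xzn zyn]]] := filter_ex (filterI Usmall (filterI xz zy)).
have [w Kw zw] := le_chain_between_close (D n) K x y z e (Dchain n) (Dcov n)
  Kconn Kx Ky xzn zyn De.
by exists w; split=> //; apply: eB; rewrite ballEmdist.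
Qed.

(** * Arcs *)

Theorem theorem4p1 (R : realType) (X : metricType R)
    (X_continuum : continuum X) (X_chainable : chainable X)
    (U : set_system nat) (U_ultra : UltraFilter U) (U_np : nonprincipal U)
    (D : nat -> seq (set X))
    (D_chain : forall n, chain (D n)) (D_covers : forall n, covers (D n))
    (D_mesh : mesh (D n) @[n --> \oo] --> 0%E)
    (P : set R)
    (P_itv : [\/ P = `]0, 1[%classic, P = `]0, 1]%classic
               | P = `[0, 1]%classic])
    (L : set X) (h : R -> X) (h_homeo : homeomorphism_on P L h)
    (leL : X -> X -> Prop)
    (leLE : forall x y, P x -> P y -> (x <= y <-> leL (h x) (h y))) :
  (forall x y, P x -> P y -> (leL (h x) (h y) <-> le_ultra D U (h x) (h y))) \/
  (forall x y, P x -> P y -> (leL (h x) (h y) <-> le_ultra D U (h y) (h x))).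
Proof.
have [[_ h_inj _] h_cont _] := h_homeo.
have Pitv a b : P a -> P b -> `[a, b] `<=` P.
  by case: P_itv => -> /=; rewrite !in_itv /= => /andP[a0 _] /andP[_ b1] c /=;
    rewrite !in_itv /= => /andP[ac cb];
    rewrite ?(lt_le_trans a0 ac) ?(le_trans a0 ac) ?(le_lt_trans cb b1)
      ?(le_trans cb b1).
(* The orientation of the arc is unknown: its ends [a] and [b] will play the
   roles of [s] and [t] in both orders. *)
have arc a b c : P a -> P b -> P c -> a <= b ->
    forall s t, s \in `[a, b] -> t \in `[a, b] ->
    le_ultra D U (h s) (h c) -> le_ultra D U (h c) (h t) -> a <= c <= b.
  move=> Pa Pb Pc ab s t sab tab sc ct.
  have h_cont_ab : {within `[a, b], continuous h}.
    exact: continuous_subspaceW (Pitv a b Pa Pb) h_cont.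
  have arc_connected : connected (h @` `[a, b]) :=
    connected_continuous_connected (@segment_connected _ a b) h_cont_ab.
  have arc_compact : compact (h @` `[a, b]) :=
    continuous_compact h_cont_ab (@segment_compact _ a b).
  have arc_closed : closed (h @` `[a, b]) :=
    compact_closed (@metric_hausdorff _ X) arc_compact.
  have : (h @` `[a, b]) (h c).
    by apply: (le_ultra_between D U _ (h s) (h t)).
  move=> [c' c'ab hc'].
  have <- : c' = c by apply: h_inj => //; rewrite inE //; exact: Pitv c'ab.
  by rewrite /= in_itv in c'ab.
have between a b c : P a -> P b -> P c ->
    le_ultra D U (h a) (h c) -> le_ultra D U (h c) (h b) ->
    a <= c <= b \/ b <= c <= a.
  move=> Pa Pb Pc ac cb; have [ab|/ltW ba] := leP a b.
    by left; apply: (arc a b c Pa Pb Pc ab a b) => //;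
      rewrite in_itv /= lexx ab.
  by right; apply: (arc b a c Pb Pa Pc ba a b) => //;
    rewrite in_itv /= lexx ba.
have [mono|anti] := total_between_monotone P
    (fun a b => le_ultra D U (h a) (h b))
    (fun a b _ _ => le_ultra_total D U (h a) (h b) U_ultra D_covers) between.
- by left=> x y Px Py; rewrite -leLE // mono.
- by right=> x y Px Py; rewrite -leLE // anti.
Qed.
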